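(* For all $n\ge 1$, $\left|\mathrm{Av}_n[\overline{14}23]\right|=C_{n-1}$, where $C_m=\frac{1}{m+1}\binom{2m}{m}$ is the $m$th Catalan number.
   Context: For $\sigma\in S_n$, the cyclic permutation $[\sigma]$ is the set of all rotations of $\sigma$; $[S_n]$ is the set of cyclic permutations of length $n$. $[\sigma]$ contains the vincular pattern $[\overline{14}23]$ if some rotation of $\sigma$ has entries $a,b,c,d$ appearing in this order with $a,b$ adjacent and $a<c<d<b$; $\mathrm{Av}_n[\overline{14}23]$ is the set of $[\sigma]\in[S_n]$ not containing it. *)

(* Defs.v *)
From mathcomp Require Import all_boot all_fingroup.
Set Implicit Arguments. Unset Strict Implicit. Unset Printing Implicit Defensive.

Definition word n (s : 'S_n) : seq nat := [seq val (s i) | i <- enum 'I_n].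

Definition cycperm n (s : 'S_n) : {set 'S_n} :=
  [set t : 'S_n | [exists k : 'I_n, word t == rot k (word s)]].

Definition cycperms n : {set {set 'S_n}} := [set cycperm s | s : 'S_n].

(* A word w (of length n) contains the vincular pattern 14-bar 23 (linear):
   entries a=w_i, b=w_{i+1}, c=w_j, d=w_l with i+1 < j < l and a<c<d<b. *)
Definition has_pat_14_23 n (w : seq nat) : bool :=
  [exists i : 'I_n, exists j : 'I_n, exists l : 'I_n,
    [&& i.+1 < j, j < l,
        nth 0 w i < nth 0 w j, nth 0 w j < nth 0 w l
      & nth 0 w l < nth 0 w i.+1]].

Definition cyc_contains n (C : {set 'S_n}) : bool :=
  [exists t in C, has_pat_14_23 n (word t)].

Definition Av_14_23 n : {set {set 'S_n}} :=
  [set C in cycperms n | ~~ cyc_contains C].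

Definition catalan (m : nat) : nat := 'C(m.*2, m) %/ m.+1.

(* Main.v *)
Require Import Defs.
From mathcomp Require Import all_boot all_fingroup.
From mathcomp Require Import zify.
Set Implicit Arguments. Unset Strict Implicit. Unset Printing Implicit Defensive.

(* Build a cyclic permutation of {0, ..., n} by inserting its maximum n
   immediately after some entry a of a cyclic permutation of {0, ..., n-1}.  The
   result avoids the pattern iff the old permutation does and the entries
   larger than a, read cyclically from a, are decreasing.  If the old
   permutation avoids the pattern, the latter holds exactly when a is at least
   the cyclic predecessor of n-1.  So avoiders correspond to weakly increasing
   sequences a_1 <= a_2 <= ... with a_i < i: an avoider with k admissible
   insertion sites has children with 2, 3, ..., k+1 sites, which is the Catalan
   generating tree. *)

(** * Ballot numbers and Catalan numbers *)

(* Number of nodes [m] generations below a node with [r] insertion sites. *)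
Fixpoint ballot (m r : nat) : nat :=
  if m is m'.+1 then \sum_(2 <= j < r.+2) ballot m' j else 1.

Lemma ballotS m r : ballot m.+1 r.+1 = ballot m.+1 r + ballot m r.+2.
Proof. exact: big_nat_recr. Qed.

(* The subtraction-free form of
   [ballot m r = 'C(2m+r-1, m) - 'C(2m+r-1, m-1)]. *)
Lemma ballotE m r :
  ballot m.+1 r + 'C(m.*2 + r.+1, m) = 'C(m.*2 + r.+1, m.+1).
Proof.
elim: m r => [|m IHm] r.
  by rewrite /= sum_nat_const_nat bin0 bin1; lia.
elim: r => [|r IHr].
  (* The sum is empty, and the two binomials agree by symmetry: [m.+1] and [m.+2] add up to the top
     entry. *)
  rewrite [ballot _ _]big_geq // add0n.
  have -> : m.+1.*2 + 1 = m.+1 + m.+2 by lia.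
  by rewrite -[RHS]bin_sub ?leq_addl // addnK.
rewrite ballotS (addnS _ r.+1) !(binS (m.+1.*2 + r.+1)) -IHr.
have := IHm r.+2; have -> : m.*2 + r.+3 = m.+1.*2 + r.+1 by lia.
by move=> <-; lia.
Qed.

(** For [r = 1], [ballotE] gives a difference of two adjacent binomials; their ratio [m.+2 / m.+1]
    turns it into the larger one divided by [m.+2]. *)
Lemma ballot_catalan m : ballot m 1 = catalan m.
Proof.
case: m => [|m]; first by rewrite /catalan bin0 divn1.
have := ballotE m 1; rewrite /catalan.
have -> : m.*2 + 2 = m.+1.*2 by lia.
have := mul_bin_left m.+1.*2 m.
have -> : m.+1.*2 - m = m.+2 by lia.
set x := ballot _ _; move=> e1 e2.
have -> : 'C(m.+1.*2, m.+1) = x * m.+2 by nia.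
by rewrite mulnK.
Qed.

(** * Cyclic avoidance for words and insertion of the maximum *)

(* No occurrence of the pattern starting at the first entry of [t]; an
   occurrence can always be rotated there. *)
Definition tail_ok (t : seq nat) : bool :=
  if t is [:: a, b & r]
  then pairwise (fun c d => ~~ [&& a < c, c < d & d < b]) r else true.

Definition cyc_avoids (t : seq nat) : Prop := forall k, tail_ok (rot k t).

Lemma cyc_avoids_cat t :
  cyc_avoids t <-> forall u v, t = u ++ v -> tail_ok (v ++ u).
Proof.
split=> [avo u v eq_t | avo k]; last by apply: avo; rewrite cat_take_drop.
by rewrite -rot_size_cat -eq_t.
Qed.

Lemma cyc_avoids_rot k t : cyc_avoids (rot k t) <-> cyc_avoids t.
Proof.
suff avo_rot j s : cyc_avoids s -> cyc_avoids (rot j s).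
  split=> [|/avo_rot //]; rewrite -{2}[t](rotK k) /rotr; exact: avo_rot.
by move=> avo i; rewrite rot_rot_add.
Qed.

(** What [tail_ok] asks of the remaining entries when the second entry is the maximum, so that the
    bound [d < b] holds for free. *)
Definition above_decr a (r : seq nat) : bool :=
  pairwise (fun c d => ~~ ((a < c) && (c < d))) r.

Lemma tail_ok_max n a r :
  all (ltn^~ n) r -> tail_ok [:: a, n & r] = above_decr a r.
Proof.
move=> lt_rn; apply: eq_in_pairwise lt_rn => c d _.
by rewrite unfold_in /= => ->; rewrite andbT.
Qed.

(** The maximum [n] can only play the top entry [b], so new occurrences are the failures of
    [above_decr a r]. Insertion breaks only the adjacency of [a] with its old successor, and
    [above_decr a r] already excludes an occurrence at that pair. *)
Lemma cyc_avoids_insert_max n a r : all (ltn^~ n) (a :: r) ->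
  cyc_avoids (a :: n :: r) <-> cyc_avoids (a :: r) /\ above_decr a r.
Proof.
move=> lt_n; have /= /andP[lt_an lt_rn] := lt_n.
(* As [n] exceeds [y], it can be neither [c] nor [d] and may be erased from the tail. *)
have drop_n x y u v : y < n ->
    pairwise (fun c d => ~~ [&& x < c, c < d & d < y]) (u ++ n :: v) =
    pairwise (fun c d => ~~ [&& x < c, c < d & d < y]) (u ++ v).
  move=> lt_yn; rewrite !pairwise_cat pairwise_cons allrel_consr.
  have -> : all (fun c => ~~ [&& x < c, c < n & n < y]) u.
    by apply/allP=> c _; lia.
  by have -> // : all (fun d => ~~ [&& x < n, n < d & d < y]) v;
    apply/allP=> c _; lia.
have tail_an := tail_ok_max a lt_rn.
rewrite !cyc_avoids_cat; split=> [avo | [avo decr] u v].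
  have decr : above_decr a r.
    by rewrite -tail_an; have := avo [::] _ erefl; rewrite cats0.
  split=> // -[|x u] v /= => [<-|[<- eq_r]].
    rewrite cats0 /=; case: r decr {lt_n lt_rn tail_an avo} => //= b r.
    by case/andP=> _; apply: sub_pairwise => c d; lia.
  have := avo [:: a, n & u] v; rewrite eq_r => /(_ erefl).
  (* For empty [v] the rotation starts at [a] again; otherwise [n] lies in the tail of the longer
     rotation and is erased. *)
  case: v eq_r => [|z [|y v]] eq_r.
  - move=> _; rewrite cat0s /=; case: u eq_r => //= b u; rewrite cats0 => eq_r.
    move: decr; rewrite eq_r /= => /andP[_].
    by apply: sub_pairwise => c d; lia.
  - by rewrite /= => /andP[].
  - rewrite /= -cat1s catA drop_n -?catA //.
    by move: lt_rn; rewrite eq_r all_cat /= => /and4P[].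
case: u => [|x [|y u]] /=.
- by move=> <-; rewrite cats0 tail_an.
- case=> <- <- /=.
  case: r {avo decr tail_an lt_n} lt_rn => //= b r /andP[lt_bn _].
  by apply/(pairwiseP 0) => i j _ _ _; lia.
case=> <- <- eq_r; case: v eq_r => [|z [|t v]] eq_r.
- by rewrite cat0s -[u]cats0 -eq_r tail_an.
- rewrite /=; have /= -> := drop_n z a [::] u lt_an.
  by have := avo (a :: u) [:: z]; rewrite eq_r /=; apply.
- rewrite /= -cat1s catA drop_n -?catA.
    by have := avo (a :: u) [:: z, t & v]; rewrite eq_r /=; apply.
  by move: lt_rn; rewrite eq_r all_cat /= => /and4P[].
Qed.

(** * Admissible insertion sites *)

Lemma prev_cat_cons2 (T : eqType) (u v : seq T) m n :
  uniq (u ++ [:: m, n & v]) -> prev (u ++ [:: m, n & v]) n = m.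
Proof.
move=> uniq_s; rewrite -(prev_rot (size u) uniq_s) rot_size_cat /= eqxx.
by case: (n =P m).
Qed.

Lemma perm_iota_max n u v :
  perm_eq (u ++ n :: v) (iota 0 n.+1) = perm_eq (u ++ v) (iota 0 n).
Proof.
rewrite -cat1s perm_catCA cat1s -addn1 iotaD cats1 perm_sym perm_rcons.
by rewrite perm_cons perm_sym.
Qed.

Lemma perm_iota_lt n s : perm_eq s (iota 0 n) -> all (ltn^~ n) s.
Proof. by move/perm_mem=> s_n; apply/allP=> x; rewrite s_n mem_iota. Qed.

(** Let [m] be the predecessor of [n]. If [a < m], then [m], [n] is an ascent above [a]. If [m < a],
    avoidance at the pair [m], [n] makes the entries above [m] decrease when read cyclically after
    [n]: those between [a] and [m] are then at most [a], and those above [a] after [n] decrease. If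
    [m = a], the same rotation gives the claim directly. *)
Lemma above_decr_prev n a r : perm_eq (a :: r) (iota 0 n.+1) ->
  cyc_avoids (a :: r) -> above_decr a r = (prev (a :: r) n <= a).
Proof.
move=> perm_s /cyc_avoids_cat avo.
have uniq_s : uniq (a :: r) by rewrite (perm_uniq perm_s) iota_uniq.
have n_s : n \in a :: r by rewrite (perm_mem perm_s) mem_iota /= add0n.
move: n_s; rewrite inE => /orP[/eqP eq_na | n_r].
  (* Case [a = n]: no entry exceeds [a], so both sides are true. *)
  have: prev (a :: r) n \in iota 0 n.+1.
    by rewrite -(perm_mem perm_s) mem_prev eq_na mem_head.
  rewrite mem_iota -eq_na ltnS /= => ->.
  move: perm_s; rewrite -eq_na (perm_iota_max n [::]) => /perm_iota_lt lt_r.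
  apply/(pairwiseP 0) => i j _ lt_j _.
  by have /= := allP lt_r _ (mem_nth 0 lt_j); lia.
have [u [v eq_r]] : exists u v, r = u ++ n :: v.
  by case/splitPr: n_r => u v; exists u, v.
move: uniq_s avo perm_s; rewrite {}eq_r {n_r}; case/lastP: u => [|u m].
  move=> uniq_s avo; rewrite (perm_iota_max n [:: a]) => /perm_iota_lt.
  rewrite all_cat => /andP[_ lt_v].
  have -> : prev (a :: [::] ++ n :: v) n = a by exact: (@prev_cat_cons2 _ [::]).
  rewrite leqnn.
  have := avo [::] _ erefl; rewrite cats0 tail_ok_max // => dec_v.
  rewrite /above_decr /=; apply/andP; split=> //.
  by apply/allP=> x /(allP lt_v) /=; lia.
rewrite -cat_cons perm_iota_max -rcons_cons !cat_rcons => uniq_s avo.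
rewrite prev_cat_cons2 // => /perm_iota_lt.
rewrite all_cat /= => /andP[/andP[lt_an lt_u] /andP[lt_mn lt_v]].
have ne_ma : m != a.
  by apply: contraL uniq_s => /eqP->; rewrite /= mem_cat !inE eqxx orbT.
have := avo (a :: u) _ erefl; rewrite tail_ok_max; last first.
  by rewrite all_cat /= lt_v lt_an lt_u.
rewrite /above_decr !pairwise_cat /= => /and4P[_ dec_v a_u dec_u].
have [lt_am|le_ma] := ltnP a m.
  by rewrite !(lt_am, lt_mn) /= !(andbF, andFb).
have lt_ma : m < a by rewrite ltn_neqAle ne_ma.
have le_ua x : x \in u -> x <= a.
  by move/(allP a_u); rewrite lt_ma /= -leqNgt.
apply/and5P; split.
- apply/allrelP=> x y /le_ua; lia.
- by apply: sub_pairwise dec_u => c d; lia.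
- by apply/allP=> x _; lia.
- by apply/allP=> x /(allP lt_v) /=; lia.
- by apply: sub_pairwise dec_v => c d; lia.
Qed.

(** * Insertion after a given entry and its inverse *)

Definition insert_after (a n : nat) (s : seq nat) : seq nat :=
  take (index a s).+1 s ++ n :: drop (index a s).+1 s.

Lemma insert_after_cat a n u v :
  a \notin u -> insert_after a n (u ++ a :: v) = u ++ [:: a, n & v].
Proof.
move=> /negbTE a_u; rewrite /insert_after index_cat a_u /= eqxx addn0.
rewrite -(cat_rcons a u v) -(cat_rcons a u (n :: v)) -(size_rcons u a).
by rewrite take_size_cat // drop_size_cat.
Qed.

Lemma mem_split_uniq (T : eqType) (a : T) s : uniq s -> a \in s ->
  exists u v, s = u ++ a :: v /\ a \notin u.
Proof.
move=> uniq_s a_s; move: uniq_s; case/splitPr: a_s => u v uniq_s.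
exists u, v; split=> //; move: uniq_s.
by rewrite cat_uniq /= negb_or => /and3P[_ /andP[]].
Qed.

(** Together with [filter_insert_after], this recovers site and parent from a child, so no child
    arises twice. *)
Lemma prev_insert_after a n s :
  uniq s -> a \in s -> n \notin s -> prev (insert_after a n s) n = a.
Proof.
move=> uniq_s a_s n_s; have [u [v [eq_s a_u]]] := mem_split_uniq uniq_s a_s.
rewrite eq_s insert_after_cat // prev_cat_cons2 //.
rewrite -cat_rcons uniq_catC /= -uniq_catC mem_cat orbC -mem_cat cat_rcons.
by rewrite -eq_s n_s.
Qed.

Lemma filter_insert_after a n s :
  n \notin s -> filter (predC1 n) (insert_after a n s) = s.
Proof.
move=> n_s; rewrite filter_cat /= eqxx -filter_cat cat_take_drop.
by apply/all_filterP/allP=> x x_s; apply: contraNneq n_s => <-.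
Qed.

(** * The generating tree of avoiders *)

(* Starting the word at 0 selects one representative of each cyclic class. *)
Definition canonical_avoider n s : Prop :=
  [/\ perm_eq s (iota 0 n.+1), head 1 s = 0 & cyc_avoids s].

Lemma canonical_avoider_insert n a u v :
  canonical_avoider n.+1 (u ++ [:: a, n.+1 & v]) <->
  canonical_avoider n (u ++ a :: v) /\ prev (u ++ a :: v) n <= a.
Proof.
rewrite /canonical_avoider -cat_rcons perm_iota_max !cat_rcons.
have <-: head 1 (u ++ a :: v) = head 1 (u ++ [:: a, n.+1 & v]) by case: u.
have [perm_s|] := boolP (perm_eq _ _); last by split=> [[]|[[]]].
have perm_r : perm_eq (a :: v ++ u) (iota 0 n.+1).
  by rewrite -cat_cons perm_catC.
have uniq_s : uniq (u ++ a :: v) by rewrite (perm_uniq perm_s) iota_uniq.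
suff avoE : cyc_avoids (u ++ [:: a, n.+1 & v]) <->
    cyc_avoids (u ++ a :: v) /\ prev (u ++ a :: v) n <= a.
  by split=> [[_ hd /avoE[]]|[[_ hd avo] le_a]]; split=> //; apply/avoE.
(* Rotating to start at [a] changes neither [cyc_avoids] nor [prev], and reaches the shape of
   [cyc_avoids_insert_max]. *)
rewrite -(cyc_avoids_rot (size u) (_ ++ [:: a, n.+1 & v])).
rewrite -(cyc_avoids_rot (size u) (u ++ a :: v)).
rewrite -(prev_rot (size u) uniq_s) !rot_size_cat !cat_cons.
rewrite (cyc_avoids_insert_max (perm_iota_lt perm_r)).
by split=> [] [avo]; rewrite (above_decr_prev perm_r).
Qed.

Lemma canonical_avoider_perm n s : canonical_avoider n s ->
  [/\ uniq s, n.+1 \notin s & s =i iota 0 n.+1].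
Proof.
case=> perm_s _ _; rewrite (perm_uniq perm_s) iota_uniq; split=> //.
  by rewrite (perm_mem perm_s) mem_iota ltnn.
exact: perm_mem.
Qed.

(** Since [s] holds every value up to [n], the sites form an interval, which [iota] can list and
    whose length is [n.+1 - prev s n]. *)
Lemma canonical_avoider_site n s a : canonical_avoider n s ->
  (a \in iota (prev s n) (n.+1 - prev s n)) = (a \in s) && (prev s n <= a).
Proof.
case/canonical_avoider_perm=> _ _ mem_s; have : prev s n \in s.
  by rewrite mem_prev mem_s mem_iota /= add0n.
by rewrite !mem_s !mem_iota /=; lia.
Qed.

Fixpoint avoiders n : seq (seq nat) :=
  if n is n'.+1 then
    [seq insert_after a n s | s <- avoiders n',
                              a <- iota (prev s n') (n - prev s n')]
  else [:: [:: 0]].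

Lemma mem_avoiders n s : s \in avoiders n <-> canonical_avoider n s.
Proof.
elim: n s => [|n IHn] s.
  rewrite inE; split=> [/eqP->|[/perm_small_eq -> //]].
  by split=> // -[|[|k]].
split=> [/allpairsPdep[s0 [a [/IHn can_s0 a_site ->]]] | can_s].
  have [uniq_s _ mem_s] := canonical_avoider_perm can_s0.
  move: a_site; rewrite canonical_avoider_site // => /andP[a_s0 le_a].
  have [u [v [eq_s0 a_u]]] := mem_split_uniq uniq_s a_s0.
  rewrite eq_s0 insert_after_cat // canonical_avoider_insert -eq_s0.
  by split.
have [perm_s hd_s _] := can_s.
have uniq_s : uniq s by rewrite (perm_uniq perm_s) iota_uniq.
have N_s : n.+1 \in s by rewrite (perm_mem perm_s) mem_iota /= add0n.
have [u [v [eq_s _]]] := mem_split_uniq uniq_s N_s.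
(* The word starts with 0, so [n.+1] has an entry [a] on its left: the site. Deleting [n.+1] gives
   the parent. *)
case/lastP: u eq_s => [|u a] eq_s; first by rewrite eq_s in hd_s.
rewrite cat_rcons in eq_s.
move: can_s; rewrite eq_s => /canonical_avoider_insert[can_s0 le_a].
apply/allpairsPdep; exists (u ++ a :: v), a; split; first exact/IHn.
  by rewrite canonical_avoider_site // mem_cat mem_head orbT.
rewrite insert_after_cat //; move: uniq_s.
by rewrite eq_s cat_uniq /= negb_or => /and3P[_ /andP[]].
Qed.

Lemma uniq_avoiders n : uniq (avoiders n).
Proof.
elim: n => // n IHn; apply: allpairs_uniq_dep => //=.
  by move=> s _; apply: iota_uniq.
move=> p q /allpairsPdep[s [a [s_n a_s ->]]].
move=> /allpairsPdep[t [b [t_n b_t ->]]] /=.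
move: s_n t_n => /mem_avoiders can_s /mem_avoiders can_t.
move: a_s b_t; rewrite !canonical_avoider_site // => /andP[a_s _] /andP[b_t _].
have [uniq_s n_s _] := canonical_avoider_perm can_s.
have [uniq_t n_t _] := canonical_avoider_perm can_t.
move=> eq_st; have := congr1 (filter (predC1 n.+1)) eq_st.
have := congr1 (prev^~ n.+1) eq_st.
by rewrite !prev_insert_after // !filter_insert_after // => -> ->.
Qed.

(** * Counting the levels of the tree *)

(** As [a] runs through [k] consecutive sites from [p], the site count [(p + k).+1 - a] of the child
    runs down from [k.+1] to 2, as in the recursion of [ballot]. *)
Lemma sum_ballot_iota m p k :
  \sum_(a <- iota p k) ballot m ((p + k).+1 - a) = ballot m.+1 k.
Proof.
elim: k p => [|k IHk] p; first by rewrite big_nil [RHS]big_geq.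
rewrite ballotS -(IHk p.+1) big_cons addnC addSnnS; congr (_ + ballot _ _).
by rewrite -addnS addKn.
Qed.

(** Descendants of the root, which has one site, are grouped by their ancestor at level [n]; the
    induction trades one generation of [m] for one level. With [m = 0] every summand is 1. *)
Lemma sum_ballot_avoiders n m :
  \sum_(s <- avoiders n) ballot m (n.+1 - prev s n) = ballot (n + m) 1.
Proof.
elim: n m => [|n IHn] m; first by rewrite big_seq1.
rewrite addSnnS -IHn big_allpairs_dep; apply: eq_big_seq => s.
move=> /mem_avoiders can_s.
have [uniq_s n_s mem_s] := canonical_avoider_perm can_s.
have le_prev : prev s n <= n.+1.
  have : prev s n \in s by rewrite mem_prev mem_s mem_iota /= add0n.
  by rewrite mem_s mem_iota /=; lia.
rewrite -(sum_ballot_iota _ (prev s n)) subnKC //; apply: eq_big_seq => a.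
rewrite canonical_avoider_site // => /andP[a_s _].
(* The predecessor of the new maximum is [a], which fixes the site count of the child. *)
by rewrite prev_insert_after.
Qed.

Lemma size_avoiders n : size (avoiders n) = catalan n.
Proof.
by rewrite -ballot_catalan -[in RHS](addn0 n) -sum_ballot_avoiders sum1_size.
Qed.

(** * Permutations, words and cyclic classes *)

Lemma size_word n (s : 'S_n) : size (word s) = n.
Proof. by rewrite size_map size_enum_ord. Qed.

Lemma nth_word n (s : 'S_n) (i : 'I_n) : nth 0 (word s) i = s i.
Proof. by rewrite (nth_map i) ?size_enum_ord // nth_ord_enum. Qed.

Lemma word_inj n : injective (@word n).
Proof.
move=> s t eq_st; apply/permP=> i; apply/val_inj.
by rewrite /= -!nth_word eq_st.
Qed.

Lemma uniq_word n (s : 'S_n) : uniq (word s).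
Proof.
by rewrite map_inj_uniq ?enum_uniq // => i j /val_inj /perm_inj.
Qed.

Lemma perm_word n (s : 'S_n) : perm_eq (word s) (iota 0 n).
Proof.
have sub_s : {subset word s <= iota 0 n}.
  by move=> x /mapP[i _ ->]; rewrite mem_iota /= add0n.
apply: uniq_perm (uniq_word s) (iota_uniq _ _) _.
by apply: (uniq_min_size (uniq_word s) sub_s _).2; rewrite size_word size_iota.
Qed.

Lemma word_surj n w : perm_eq w (iota 0 n.+1) -> exists s : 'S_n.+1, word s = w.
Proof.
move=> perm_w.
have size_w : size w = n.+1 by rewrite (perm_size perm_w) size_iota.
have lt_w (i : 'I_n.+1) : nth 0 w i < n.+1.
  have : nth 0 w i \in w by rewrite mem_nth // size_w.
  by rewrite (perm_mem perm_w) mem_iota.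
have inj_w : injective (fun i : 'I_n.+1 => Ordinal (lt_w i)).
  move=> i j [/eqP]; rewrite nth_uniq ?size_w // => [/eqP/val_inj //|].
  by rewrite (perm_uniq perm_w) iota_uniq.
exists (perm inj_w); apply: (@eq_from_nth _ 0); rewrite size_word ?size_w //.
by move=> i lt_i; rewrite (nth_word _ (Ordinal lt_i)) permE.
Qed.

Lemma mem_cycperm n (s t : 'S_n.+1) :
  t \in cycperm s <-> exists k, word t = rot k (word s).
Proof.
rewrite inE; split=> [/existsP[k /eqP ->]|[k eq_t]]; first by exists k.
apply/existsP; have [lt_k|le_k] := ltnP k n.+1.
  by exists (Ordinal lt_k); apply/eqP.
by exists ord0; rewrite eq_t rot_oversize ?size_word // rot0.
Qed.

Lemma cycperm_eq n (s t : 'S_n.+1) : t \in cycperm s -> cycperm t = cycperm s.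
Proof.
case/mem_cycperm=> k eq_t; apply/setP=> x; apply/idP/idP=> /mem_cycperm[j eq_x];
  apply/mem_cycperm.
  by rewrite eq_x eq_t rot_rot_add; eexists.
by rewrite eq_x -(rotK k (word s)) -eq_t /rotr rot_rot_add; eexists.
Qed.

Lemma cycperm_id n (s : 'S_n.+1) : s \in cycperm s.
Proof. by apply/mem_cycperm; exists 0; rewrite rot0. Qed.

(** * Pattern containment as a condition on rotations *)

Lemma has_pat_tail n w : size w = n -> ~~ tail_ok w -> has_pat_14_23 n w.
Proof.
case: n w => [|n] [|a [|b r]] // [size_r]; apply: contraNT => no_pat.
apply/(pairwiseP 0) => i j; rewrite !inE => lt_i lt_j lt_ij.
apply: contra no_pat => /and3P[lt_a lt_nth lt_b].
have lt_i2 : i.+2 < n.+1 by rewrite -size_r.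
have lt_j2 : j.+2 < n.+1 by rewrite -size_r.
apply/existsP; exists ord0; apply/existsP; exists (Ordinal lt_i2).
apply/existsP; exists (Ordinal lt_j2).
by rewrite /= !ltnS lt_ij lt_a lt_nth lt_b.
Qed.

(** Rotating by [i] brings the adjacent pair to the front; the other two entries lie to its right
    and keep their order. *)
Lemma has_pat_rot n w :
  size w = n -> has_pat_14_23 n w -> exists k, ~~ tail_ok (rot k w).
Proof.
move=> size_w /existsP[i /existsP[j /existsP[l]]].
case/and5P=> lt_ij lt_jl lt_a lt_nth lt_b; exists i.
have lt_l : l < size w by rewrite size_w.
have lt_i1 : i.+1 < size w by lia.
rewrite /rot (drop_nth 0 (ltnW lt_i1)) (drop_nth 0 lt_i1) /=.
set r := drop _ _ ++ _.
(* With the leading pair removed, position [x] of [w] becomes [x - i.+2]. *)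
have nth_r x : i.+1 < x < size w -> nth 0 r (x - i.+2) = nth 0 w x.
  case/andP=> lt_ix lt_x.
  rewrite nth_cat size_drop ltn_sub2r ?nth_drop ?subnKC //.
  exact: leq_ltn_trans lt_x.
have size_r : size w - i.+2 <= size r by rewrite size_cat size_drop leq_addr.
apply/negP=> /(pairwiseP 0)/(_ (j - i.+2) (l - i.+2)).
by rewrite !inE !nth_r; lia.
Qed.

Lemma cyc_contains_cycperm n (s : 'S_n.+1) :
  ~~ cyc_contains (cycperm s) <-> cyc_avoids (word s).
Proof.
split=> [no_pat k | avo].
  have [|t eq_t] := @word_surj n (rot k (word s)).
    by rewrite perm_rot perm_word.
  apply: contraNT no_pat => tail_k; apply/existsP; exists t.
  rewrite has_pat_tail ?size_word ?eq_t // andbT.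
  by apply/mem_cycperm; exists k.
apply/negP=> /existsP[t /andP[/mem_cycperm[j eq_t]]].
case/has_pat_rot=> [|k]; first exact: size_word.
by rewrite eq_t rot_rot_add avo.
Qed.

(** * One representative per cyclic class, and the final count *)

Lemma head_word_cycperm n (s : 'S_n.+1) :
  exists2 t, t \in cycperm s & head 1 (word t) = 0.
Proof.
have mem0 : 0 \in word s by rewrite (perm_mem (perm_word s)) mem_iota.
have [k r eq_r] := rot_to mem0.
have [|t eq_t] := @word_surj n (rot k (word s)).
  by rewrite perm_rot perm_word.
exists t; first by apply/mem_cycperm; exists k.
by rewrite eq_t eq_r.
Qed.

(** The entries of a word are distinct, so only the trivial rotation keeps 0 in front. *)
Lemma cycperm_head_inj n (s t : 'S_n.+1) :
  head 1 (word s) = 0 -> head 1 (word t) = 0 -> cycperm s = cycperm t -> s = t.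
Proof.
move=> hd_s hd_t eq_st; apply: word_inj.
have /mem_cycperm[k] : s \in cycperm t by rewrite -eq_st cycperm_id.
have [lt_k|le_k] := ltnP k (size (word t)); last by rewrite rot_oversize.
move: hd_s hd_t => + + eq_s; rewrite eq_s /rot (drop_nth 1) //= => nth_k.
rewrite -nth0 => nth_0; suff -> : k = 0.
  by rewrite take0 cats0 -drop_nth ?drop0 ?size_word.
apply/eqP; rewrite -(nth_uniq 1 lt_k _ (uniq_word t)) ?nth_k ?nth_0 //.
exact: leq_ltn_trans lt_k.
Qed.

Lemma card_word_avoiders n :
  #|[set t : 'S_n.+1 | word t \in avoiders n]| = size (avoiders n).
Proof.
rewrite cardE -(size_map (@word n.+1)); apply/perm_size/uniq_perm.
- by rewrite map_inj_uniq ?enum_uniq //; apply: word_inj.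
- exact: uniq_avoiders.
move=> w; apply/mapP/idP => [[t] | w_av].
  by rewrite mem_enum inE => t_av ->.
have /mem_avoiders[/word_surj[t eq_t] _ _] := w_av.
by exists t; rewrite // mem_enum inE eq_t.
Qed.

Lemma Av_14_23E n :
  Av_14_23 n.+1 = [set cycperm t | t in [set t | word t \in avoiders n]].
Proof.
apply/setP=> C; rewrite inE; apply/andP/imsetP.
  case=> /imsetP[s _ ->] no_pat; have [t t_s hd_t] := head_word_cycperm s.
  exists t; last by rewrite (cycperm_eq t_s).
  rewrite inE; apply/mem_avoiders; split; rewrite ?perm_word //.
  by apply/cyc_contains_cycperm; rewrite (cycperm_eq t_s).
case=> t; rewrite inE => /mem_avoiders[_ _ avo] ->; split.
  exact: imset_f.
exact/cyc_contains_cycperm.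
Qed.

Theorem theorem5p9 (n : nat) : 1 <= n -> #|Av_14_23 n| = catalan n.-1.
Proof.
case: n => // n _; rewrite Av_14_23E card_in_imset.
  by rewrite card_word_avoiders size_avoiders.
move=> s t; rewrite !inE => /mem_avoiders[_ hd_s _] /mem_avoiders[_ hd_t _].
exact: cycperm_head_inj.
Qed.
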